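(* Let $G$ be a finitely generated group. All asymptotic cones of $G$ have no cut-points if and only if the divergence function $\mathrm{Div}_{2}\left(n;\tfrac12\right)$ of $G$ is linear.
   Context: The group $G$ is identified with a Cayley graph with respect to some finite generating set, viewed as a geodesic metric space. Divergence. Let $(X,\mathrm{dist})$ be a geodesic metric space, $0<\delta<1$, $\gamma\ge 0$. For $a,b,c\in X$ with $r=\mathrm{dist}(c,\{a,b\})=\min(\mathrm{dist}(c,a),\mathrm{dist}(c,b))>0$, let $\mathrm{div}_\gamma(a,b,c;\delta)$ be the infimum of the lengths of paths connecting $a$ and $b$ and avoiding the ball $B(c,\delta r-\gamma)$ (a ball of non-positive radius is empty); if no such path exists, $\mathrm{div}_\gamma(a,b,c;\delta)=\infty$. The divergence function $\mathrm{Div}_\gamma(n;\delta)$ is the supremum of all $\mathrm{div}_\gamma(a,b,c;\delta)$ with $\mathrm{dist}(a,b)\le n$. Equivalence of functions. Functions are considered up to equivalence: $f\preceq g$ if for some $C>1$, $f(n)\le Cg(Cn)+Cn+C$ for all $n$; $f\equiv g$ if $f\preceq g$ and $g\preceq f$. All linear functions (including constants) are equivalent; ''linear'' means equivalent to a linear function, i.e. bounded above by $Cn+C$ for some constant $C$. Asymptotic cones. For a non-principal ultrafilter $\omega$ on $\mathbb N$, a sequence $(o_n)$ in $X$ and positive scaling constants $d_n$ with $\lim_\omega d_n=\infty$, the asymptotic cone $\mathrm{Con}^\omega(X,(o_n),(d_n))$ is the quotient of the set of sequences $(x_n)$ in $X$ with $\lim_\omega \mathrm{dist}(x_n,o_n)/d_n<\infty$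 by the relation $\lim_\omega \mathrm{dist}(x_n,y_n)/d_n=0$, with metric $\lim_\omega \mathrm{dist}(x_n,y_n)/d_n$. ''All asymptotic cones'' refers to all choices of $\omega,(o_n),(d_n)$. A cut-point is a point whose removal disconnects the space. *)

(* Defs.v *)
From HB Require Import structures.
From mathcomp Require Import all_boot all_order all_algebra generic_quotient.
From mathcomp Require Import all_classical all_reals all_analysis.

Set Implicit Arguments.
Unset Strict Implicit.
Unset Printing Implicit Defensive.

Import Order.TTheory GRing.Theory Num.Theory.
Import numFieldNormedType.Exports.

Local Open Scope classical_set_scope.
Local Open Scope ring_scope.

(** * Divergence of a metric space *)

Section Divergence.
Context {R : realType} {X : metricType R}.

Definition path_length (f : R -> X) : \bar R :=
  ereal_sup [set (\sum_(0 <= i < size s)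
                    mdist (f (nth 1 (0 :: s) i)) (f (nth 1 (0 :: s) i.+1)))%:E
            | s in itv_partition 0 1].

Definition path_avoiding (A : set X) (a b : X) (f : R -> X) : Prop :=
  [/\ {within `[0, 1], continuous f}, f 0 = a, f 1 = b
    & forall t, t \in `[0, 1] -> ~ A (f t)].

Definition dist_to_pair (c a b : X) : R := Num.min (mdist c a) (mdist c b).

(* [ball c e] is the open ball, hence empty when [e <= 0]; the infimum of the
   empty set is [+oo]. *)
Definition divergence (gamma delta : R) (a b c : X) : \bar R :=
  ereal_inf [set path_length f | f in
    path_avoiding (ball c (delta * dist_to_pair c a b - gamma)) a b].

(* [ereal_sup set0] is [-oo]; the maximum with [0] makes the supremum one in
   [0, +oo], which matters only when X has at most one point. *)
Definition Div (gamma delta : R) (n : R) : \bar R :=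
  Order.max 0%E
    (ereal_sup [set e | exists a b c : X,
       [/\ mdist a b <= n, 0 < dist_to_pair c a b & e = divergence gamma delta a b c]]).

End Divergence.

Arguments Div {R} X gamma delta n.

(** * Equivalence of functions [0, +oo[ -> [0, +oo] *)

Section Growth.
Context {R : realType}.
Implicit Types f g : R -> \bar R.

Definition growth_le f g : Prop :=
  exists2 C : R, 1 < C & forall n, 0 <= n ->
    (f n <= C%:E * g (C * n)%R + (C * n + C)%R%:E)%E.

Definition growth_equiv f g : Prop := growth_le f g /\ growth_le g f.

Definition linear_growth f : Prop :=
  exists a b : R, [/\ 0 <= a, 0 <= b
    & growth_equiv f (fun n => (a * n + b)%:E)].

End Growth.

(** * Cayley graphs *)

Definition generates (G : groupType) (S : seq G) : Prop :=
  forall H : {pred G}, group_closed H -> {subset S <= H} -> H =i predT.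

Section CayleyPoints.
Context (R : realType) (G : groupType) (S : seq G).
Local Open Scope group_scope.

(* The closed cells of the graph are the vertices (g = h) and the edges; a
   trivial generator adds no edge and inverse generators give the same edge. *)
Definition cayley_cell (g h : G) : Prop :=
  g = h \/ exists2 s, s \in S & h = g * s \/ g = h * s.

Local Open Scope ring_scope.

Definition barycentric (g h : G) (t : R) : G -> R :=
  fun k => (1 - t) * (k == g)%:R + t * (k == h)%:R.

Definition in_cell (g h : G) (x : G -> R) : Prop :=
  exists2 t, 0 <= t <= 1 & x = barycentric g h t.

(* Points of the geometric realization, in barycentric coordinates. *)
Record cayley_point := CayleyPoint {
  coords :> G -> R ;
  coordsP : exists g h, cayley_cell g h /\ in_cell g h coords }.

HB.instance Definition _ := Choice.copy cayley_point {classic cayley_point}.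

(* [cell_segment x y l]: x and y lie in a common closed cell, at distance l
   when edges are given length 1. *)
Definition cell_segment (x y : cayley_point) (l : R) : Prop :=
  exists g h, [/\ cayley_cell g h, in_cell g h x, in_cell g h y
                & l = `|x g - y g|].

Inductive segment_chain : cayley_point -> cayley_point -> R -> Prop :=
| segment_chain0 x : segment_chain x x 0
| segment_chainS x y z l m :
    cell_segment x y l -> segment_chain y z m -> segment_chain x z (l + m).

(* The infimum of the lengths of the piecewise linear paths from x to y. *)
Definition cayley_dist (x y : cayley_point) : R :=
  inf [set l | segment_chain x y l].

End CayleyPoints.

Definition cayley_graph (R : realType) (G : groupType) (S : seq G)
  (genS : generates S) : Type := cayley_point R S.
Arguments cayley_graph R {G S} genS.

Section CayleyMetric.
Context (R : realType) (G : groupType) (S : seq G) (genS : generates S).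
Implicit Types x y z : cayley_point R S.

Lemma cayley_point_eq x y : (forall k, x k = y k) -> x = y.
Proof.
case: x y => [x px] [y py] /= /funext xy; subst y.
by congr CayleyPoint; exact: Prop_irrelevance.
Qed.

Lemma cell_segment_sym x y l : cell_segment x y l -> cell_segment y x l.
Proof. by move=> [g [h [gh xg yg ->]]]; exists g, h; rewrite distrC. Qed.

Lemma segment_chain_cat x y z l m :
  segment_chain x y l -> segment_chain y z m -> segment_chain x z (l + m).
Proof.
elim=> [{}x|{}x u {}y k j xu _ ih] yz; first by rewrite add0r.
by rewrite -addrA; apply: segment_chainS xu _; exact: ih.
Qed.

Lemma segment_chain1 x y l : cell_segment x y l -> segment_chain x y l.
Proof.
by move=> xy; rewrite -[l]addr0; apply: segment_chainS xy _; constructor.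
Qed.

Lemma segment_chain_sym x y l : segment_chain x y l -> segment_chain y x l.
Proof.
elim=> [{}x|{}x u {}y k j xu _ ih]; first by constructor.
rewrite addrC; apply: segment_chain_cat ih _.
exact/segment_chain1/cell_segment_sym.
Qed.

Lemma cell_segment_coord x y l k : cell_segment x y l -> `|x k - y k| <= l.
Proof.
move=> [g [h [_ [t _ ->] [u _ ->] ->]]]; rewrite /barycentric eqxx.
have [->|gh] := eqVneq g h.
  by rewrite !mulr1 !subrK -!mulrDl !subrK subrr normr0.
have [->|kg] := eqVneq k g; first by rewrite (negbTE gh).
have [_|kh] := eqVneq k h; last by rewrite !mulr0 !addr0 subrr normr0.
rewrite !mulr0 !mulr1 !addr0 !add0r [leRHS](_ : _ = `|u - t|).
  by rewrite distrC.
by congr `|_|; rewrite opprB addrC addrA subrK.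
Qed.

Lemma segment_chain_coord x y l k : segment_chain x y l -> `|x k - y k| <= l.
Proof.
elim=> [{}x|{}x u {}y i j xu _ ih]; first by rewrite subrr normr0.
rewrite (le_trans (ler_distD (u k) _ _))// lerD//.
exact: cell_segment_coord xu.
Qed.

Lemma vertexP (g : G) :
  exists g' h, cayley_cell S g' h /\ in_cell g' h (barycentric g g (0 : R)).
Proof.
by exists g, g; split; [left|exists 0 => //; rewrite lexx ler01].
Qed.

Definition vertex (g : G) : cayley_point R S := CayleyPoint (vertexP g).

Let joined x y := exists l, segment_chain x y l.

Let joined_sym x y : joined x y -> joined y x.
Proof. by move=> [l xy]; exists l; exact: segment_chain_sym. Qed.

Let joined_trans y x z : joined x y -> joined y z -> joined x z.
Proof. by move=> [l xy] [m yz]; exists (l + m); exact: segment_chain_cat yz. Qed.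

Let joined_cell g h x y : cayley_cell S g h -> in_cell g h x -> in_cell g h y ->
  joined x y.
Proof.
by move=> gh xg yg; eexists; apply: segment_chain1; exists g, h; split.
Qed.

Let in_cell_l g h : in_cell g h (vertex g).
Proof.
exists 0; first by rewrite lexx ler01.
by apply/funext => k; rewrite /= /barycentric !mul0r.
Qed.

Let in_cell_r g h : in_cell g h (vertex h).
Proof.
exists 1; first by rewrite ler01 lexx.
by apply/funext => k; rewrite /= /barycentric subrr subr0 !mul0r addr0 add0r.
Qed.

Let joined_vertex g h : joined (vertex g) (vertex h).
Proof.
pose H : {pred G} := [pred k | `[< forall u, joined (vertex u) (vertex (u * k)%g) >]].
have H_closed : group_closed H.
  split=> [|k k' /asboolP Hk /asboolP Hk']; apply/asboolP => u.
    by rewrite mulg1; exists 0; constructor.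
  apply: joined_trans (Hk u) _; apply: joined_sym.
  by have := Hk' (u * (k / k'))%g; rewrite -!mulgA mulVg mulg1.
have subH : {subset S <= H}.
  move=> s Ss; apply/asboolP => u; apply: (@joined_cell u (u * s)%g) => //.
  by right; exists s => //; left.
have /asboolP/(_ g) : (g^-1 * h)%g \in H by rewrite (genS H_closed subH).
by rewrite mulVKg.
Qed.

Let joinedT x y : joined x y.
Proof.
have to_vertex z : exists g, joined z (vertex g).
  have [g [h [gh zg]]] := coordsP z; exists g.
  exact: joined_cell gh zg (in_cell_l _ _).
have [g xg] := to_vertex x; have [h yh] := to_vertex y.
apply: joined_trans xg (joined_trans (joined_vertex g h) _).
exact: joined_sym.
Qed.

Lemma segment_chain_has_inf x y : has_inf [set l | segment_chain x y l].
Proof.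
split; first exact: joinedT.
by exists 0 => l /= /(segment_chain_coord 1%g); exact: le_trans.
Qed.

Lemma cayley_dist_le x y l : segment_chain x y l -> cayley_dist x y <= l.
Proof.
by move=> xy; apply: ge_inf => //; exact: (segment_chain_has_inf x y).2.
Qed.

Lemma le_cayley_dist x y r :
  (forall l, segment_chain x y l -> r <= l) -> r <= cayley_dist x y.
Proof. by move=> xy; apply: lb_le_inf => //; exact: joinedT. Qed.

Let cayley_distxx x : cayley_dist x x = 0.
Proof.
apply/le_anti/andP; split; first by apply: cayley_dist_le; constructor.
by apply: le_cayley_dist => l /(segment_chain_coord 1%g); exact: le_trans.
Qed.

Let cayley_dist_eq0 x y : cayley_dist x y = 0 -> x = y.
Proof.
move=> xy0; apply: cayley_point_eq => k; apply/eqP.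
rewrite -subr_eq0 -normr_le0 -xy0.
by apply: le_cayley_dist => l; exact: segment_chain_coord.
Qed.

Let cayley_distC x y : cayley_dist x y = cayley_dist y x.
Proof.
by apply/le_anti/andP; split; apply: le_cayley_dist => l /segment_chain_sym;
  exact: cayley_dist_le.
Qed.

Let cayley_dist_triangle y x z :
  cayley_dist x z <= cayley_dist x y + cayley_dist y z.
Proof.
rewrite -lerBlDr; apply: le_cayley_dist => l xy.
rewrite lerBlDr -lerBlDl; apply: le_cayley_dist => m yz.
by rewrite lerBlDl; apply: cayley_dist_le; exact: segment_chain_cat yz.
Qed.

HB.instance Definition _ := Choice.copy (cayley_graph R genS) (cayley_point R S).
HB.instance Definition _ := @isMetric.Build R (cayley_graph R genS)
  (@cayley_dist R G S) cayley_distxx cayley_dist_eq0 cayley_distC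
  cayley_dist_triangle.

End CayleyMetric.

(** * Asymptotic cones *)

Definition nonprincipal (T : Type) (w : set_system T) : Prop :=
  forall t, ~ w [set t].

Section AsymptoticCone.
Context {R : realType} {X : metricType R}.
Context (w : set_system nat) {wU : UltraFilter w}.
Context (o : nat -> X) (d : nat -> {posnum R}).

Definition scaled_dist (x y : nat -> X) : nat -> R :=
  fun n => mdist (x n) (y n) / (d n)%:num.

(* A limit in R, i.e. a finite limit. *)
Record cone_seq := ConeSeq {
  cone_val :> nat -> X ;
  cone_valP : cvg (scaled_dist cone_val o @ w) }.

HB.instance Definition _ := Choice.copy cone_seq {classic cone_seq}.

Definition cone_pdist (x y : cone_seq) : R := lim (scaled_dist x y @ w).

Lemma cvg_ultra_bounded (u : nat -> R) (A B : R) :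
  (\forall n \near w, A <= u n <= B) -> cvg (u @ w).
Proof.
move=> uAB; have := @segment_compact R A B; rewrite compact_ultra.
have uU : UltraFilter (u @ w).
  split=> [|F FF uF]; first exact: fmap_proper_filter.
  apply/seteqP; split=> [Y FY|]; last exact: uF.
  have [//|wY] := in_ultra_setVsetC (u @^-1` Y) wU.
  have : F (Y `&` ~` Y) by apply: filterI => //; exact: uF.
  by rewrite setICr => /filter_not_empty.
case/(_ (u @ w) uU) => [|l [_ ul]]; last by apply/cvg_ex; exists l.
by apply: filterS uAB => n; rewrite /= in_itv.
Qed.

Lemma is_cvg_cone_pdist (x y : cone_seq) : cvg (scaled_dist x y @ w).
Proof.
pose l : R := lim (scaled_dist x o @ w) + lim (scaled_dist y o @ w).
have xyo : scaled_dist x o n + scaled_dist y o n @[n --> w] --> l.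
  by apply: cvgD; exact: cone_valP.
apply: (@cvg_ultra_bounded _ 0 (l + 1)).
have : \forall n \near w, scaled_dist x o n + scaled_dist y o n <= l + 1.
  by apply: (cvgr_le l xyo); rewrite ltrDl ltr01.
apply: filterS => n; rewrite /scaled_dist divr_ge0 ?mdist_ge0//=.
apply: le_trans; rewrite -mulrDl ler_pM2r ?invr_gt0//.
by rewrite [mdist (y n) _]metric_sym; exact: metric_triangle.
Qed.

Lemma cone_pdistxx x : cone_pdist x x = 0.
Proof.
rewrite /cone_pdist; apply/cvg_lim => //.
rewrite (_ : scaled_dist x x = cst 0); first exact: cvg_cst.
by apply/funext => n; rewrite /scaled_dist mdistxx mul0r.
Qed.

Lemma cone_pdistC x y : cone_pdist x y = cone_pdist y x.
Proof.
rewrite /cone_pdist (_ : scaled_dist x y = scaled_dist y x)//.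
by apply/funext => n; rewrite /scaled_dist metric_sym.
Qed.

Lemma cone_pdist_triangle y x z :
  cone_pdist x z <= cone_pdist x y + cone_pdist y z.
Proof.
rewrite /cone_pdist -limD; [|exact: is_cvg_cone_pdist..].
apply: ler_lim; [exact: is_cvg_cone_pdist|
  by apply: is_cvgD; exact: is_cvg_cone_pdist|].
apply: nearW => n; rewrite /scaled_dist /= -mulrDl ler_pM2r ?invr_gt0//.
exact: metric_triangle.
Qed.

Lemma cone_pdist_ge0 x y : 0 <= cone_pdist x y.
Proof.
rewrite -(@pmulrn_lge0 _ _ 2)// -(cone_pdistxx x).
by rewrite (le_trans (cone_pdist_triangle y _ _))// [cone_pdist y x]cone_pdistC
  -mulr2n.
Qed.

Definition cone_eqv (x y : cone_seq) : bool := cone_pdist x y == 0.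

Lemma cone_eqv_refl : reflexive cone_eqv.
Proof. by move=> x; rewrite /cone_eqv cone_pdistxx. Qed.

Lemma cone_eqv_sym : symmetric cone_eqv.
Proof. by move=> x y; rewrite /cone_eqv cone_pdistC. Qed.

Lemma cone_eqv_trans : transitive cone_eqv.
Proof.
move=> y x z /eqP xy /eqP yz; rewrite /cone_eqv eq_le cone_pdist_ge0 andbT.
by rewrite (le_trans (cone_pdist_triangle y _ _))// xy yz addr0.
Qed.

Canonical cone_eqv_equiv :=
  EquivRel cone_eqv cone_eqv_refl cone_eqv_sym cone_eqv_trans.

Local Open Scope quotient_scope.

Definition asymptotic_cone : Type := {eq_quot cone_eqv}.

HB.instance Definition _ := Choice.copy asymptotic_cone {eq_quot cone_eqv}.

Definition cone_point (x : cone_seq) : asymptotic_cone := \pi_({eq_quot cone_eqv}) x.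

Definition cone_repr (a : asymptotic_cone) : cone_seq :=
  repr (a : {eq_quot cone_eqv}).

Definition cone_dist (a b : asymptotic_cone) : R :=
  cone_pdist (cone_repr a) (cone_repr b).

Lemma cone_reprK : cancel cone_repr cone_point.
Proof. by move=> a; exact: (@reprK _ {eq_quot cone_eqv}). Qed.

Lemma cone_pointP (x y : cone_seq) :
  cone_point x = cone_point y <-> cone_pdist x y = 0.
Proof.
split=> [/eqmodP/eqP//|xy0].
by apply/eqmodP/eqP.
Qed.

(* [cone_dist] does not depend on the choice of representatives. *)
Lemma cone_distE (x y : cone_seq) :
  cone_dist (cone_point x) (cone_point y) = lim (scaled_dist x y @ w).
Proof.
rewrite -/(cone_pdist x y) /cone_dist.
have reprx z : cone_pdist z (cone_repr (cone_point z)) = 0.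
  by apply/cone_pointP; rewrite cone_reprK.
set x' := cone_repr _; set y' := cone_repr _.
apply/le_anti/andP; split.
- rewrite (le_trans (cone_pdist_triangle x _ _))// cone_pdistC reprx add0r.
  by rewrite (le_trans (cone_pdist_triangle y _ _))// reprx addr0.
- rewrite (le_trans (cone_pdist_triangle x' _ _))// reprx add0r.
  by rewrite (le_trans (cone_pdist_triangle y' _ _))// (cone_pdistC y') reprx addr0.
Qed.

Let cone_distxx a : cone_dist a a = 0.
Proof. exact: cone_pdistxx. Qed.

Let cone_dist_eq0 a b : cone_dist a b = 0 -> a = b.
Proof. by move/cone_pointP; rewrite !cone_reprK. Qed.

Let cone_distC a b : cone_dist a b = cone_dist b a.
Proof. exact: cone_pdistC. Qed.

Let cone_dist_triangle b a c : cone_dist a c <= cone_dist a b + cone_dist b c.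
Proof. exact: cone_pdist_triangle. Qed.

HB.instance Definition _ := @isMetric.Build R asymptotic_cone
  cone_dist cone_distxx cone_dist_eq0 cone_distC cone_dist_triangle.

End AsymptoticCone.

Arguments asymptotic_cone {R X} w {wU} o d.

Definition cut_point {T : topologicalType} (p : T) : Prop := ~ connected [set~ p].

(* Main.v *)
Require Import Defs.
From mathcomp Require Import all_boot all_order all_algebra.
From mathcomp Require Import all_classical all_reals all_analysis.
From mathcomp Require Import ring lra.

(** Linear divergence gives, between two points of a cone other than p, paths of
linearly bounded length avoiding balls around representatives of p of linear
radius; their limit is a Lipschitz path of the cone avoiding p.

Conversely, suppose that a_n and b_n are at distance D_n, and that no path of
length at most n^2 (D_n + 1) joins them outside the ball around c_n of radius
r_n / 2 - 2. Then r_n <= D_n. If the group is infinite, a_n is near the middle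
of arbitrarily long geodesics, of which one half must avoid this ball. Hence
a_n and b_n can be moved, outside the ball, to distance about n D_n from c_n. In
the cone with scale n D_n the balls collapse to a point, which is not a
cut-point, and a path around it in the cone lifts to a path of length
O(n D_n), a contradiction. If the group is finite, a ball that separates two
far points has translates that separate points further and further away. *)

Set Implicit Arguments.
Unset Strict Implicit.
Unset Printing Implicit Defensive.

Import Order.TTheory GRing.Theory Num.Theory.
Import numFieldNormedType.Exports.

Local Open Scope classical_set_scope.
Local Open Scope ring_scope.

(** * Retraction of the line onto the unit interval *)

Section Clip.
Context {R : realType}.

(** Makes maps given on [[0, 1]] total, so that Lipschitz bounds can be stated on the whole line. *)
Definition clip (t : R) : R := Num.max 0 (Num.min 1 t).

Lemma clip01 t : clip t \in `[0, 1].
Proof. by rewrite in_itv/= le_max lexx ge_max ler01 ge_min lexx. Qed.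

Lemma clip_id t : t \in `[0, 1] -> clip t = t.
Proof.
by rewrite in_itv/= => /andP[t0 t1]; rewrite /clip (min_idPr t1) (max_idPr t0).
Qed.

Lemma clip_nonexpansive s t : `|clip s - clip t| <= `|s - t|.
Proof.
have mono u v : u <= v -> 0 <= clip v - clip u <= v - u.
  by rewrite /clip /Order.max /Order.min; do !case: ifPn => //; rewrite -?leNgt; lra.
have [st|/ltW ts] := leP s t.
  by rewrite 2?ler0_norm; have := mono _ _ st; lra.
by rewrite 2?ger0_norm; have := mono _ _ ts; lra.
Qed.

End Clip.

(** * Avoiding paths of bounded length *)

Section Paths.
Context {R : realType} {X : metricType R}.
Implicit Types (A B : set X) (x y z a b c : X).

Definition nonexpansive (f : R -> X) := forall s t, mdist (f s) (f t) <= `|s - t|.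

(** As [f] is nonexpansive, [T] bounds its length; only the values between times 0 and [T] have to
    avoid [A]. *)
Definition joined A (K : R) x y := exists T f,
  [/\ 0 <= T <= K, nonexpansive f, f 0 = x, f T = y
    & forall t, 0 <= t <= T -> ~ A (f t)].

Lemma joined_refl A K x : 0 <= K -> ~ A x -> joined A K x x.
Proof.
move=> K0 Ax; exists 0, (fun=> x); split=> //; first by rewrite lexx.
by move=> s t; rewrite mdistxx.
Qed.

Lemma joined_sym A K x y : joined A K x y -> joined A K y x.
Proof.
move=> [T [f [TK f1 f0 fT fA]]]; exists T, (fun t => f (T - t)); split=> //.
- move=> s t; rewrite (le_trans (f1 _ _))// [leRHS]distrC.
  by rewrite (_ : T - s - (T - t) = t - s)//; ring.
- by rewrite subr0.
- by rewrite subrr.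
- by move=> t tT; apply: fA; lra.
Qed.

Lemma joinedW A B K L x y : A `<=` B -> K <= L -> joined B K x y -> joined A L x y.
Proof.
move=> AB KL [T [f [TK f1 f0 fT fA]]]; exists T, f; split=> //; first by lra.
by move=> t tT /AB; exact: fA.
Qed.

Lemma joined_trans A K L y x z : joined A K x y -> joined A L y z ->
  joined A (K + L) x z.
Proof.
move=> [T [f [TK f1 f0 fT fA]]] [U [g [UL g1 g0 gU gA]]].
exists (T + U), (fun t => if t <= T then f t else g (t - T)); split.
- lra.
- suff H s t : s <= t -> mdist (if s <= T then f s else g (s - T))
      (if t <= T then f t else g (t - T)) <= `|s - t|.
    move=> s t; have [/H//|/ltW/H] := leP s t.
    by rewrite metric_sym distrC.
  move=> st; case: ifPn => sT; case: ifPn => tT.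
  + exact: f1.
  + have := metric_triangle (f s) (f T) (g (t - T)).
    have := f1 s T; have := g1 0 (t - T).
    rewrite -ltNge in tT.
    rewrite fT g0 !ler0_norm; lra.
  + by rewrite -ltNge in sT; lra.
  + by rewrite (le_trans (g1 _ _))// opprB addrA subrK.
- by rewrite ifT//; lra.
- case: ifPn => [TUT|]; last by rewrite [T + U]addrC addrK.
  by have -> : T + U = T; [lra|rewrite fT -gU -g0; congr g; lra].
- move=> t tTU; case: ifPn => tT; first by apply: fA; lra.
  by apply: gA; rewrite -ltNge in tT; lra.
Qed.

Lemma joined_prefix A K B x y : joined A K x y ->
  joined B K x y \/ exists2 z, B z & joined A K x z.
Proof.
move=> [T [f [TK f1 f0 fT fA]]].
have [fB|] := pselect (forall t, 0 <= t <= T -> ~ B (f t)).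
  by left; exists T, f; split.
move=> /existsNP[t /not_implyP[tT /contrapT Bt]]; right; exists (f t) => //.
exists t, f; split=> //; first by lra.
by move=> s st; apply: fA; lra.
Qed.

(** Almost geodesics, with an arbitrary error [e]: they come directly from the infimum defining
    [cayley_dist]. *)
Definition length_space := forall x y (e : R), 0 < e ->
  joined set0 (mdist x y + e) x y.

(** Every point of an almost geodesic nearly realizes equality in the triangle inequality, so it is
    enough to keep such points out of [A]. *)
Lemma length_space_joined A (e : R) x y : length_space -> 0 < e ->
  (forall z, mdist x z + mdist z y <= mdist x y + e -> ~ A z) ->
  joined A (mdist x y + e) x y.
Proof.
move=> XL e0 xyA; have [T [f [TK f1 f0 fT _]]] := XL x y e e0.
exists T, f; split=> // t tT; apply: xyA.
have := f1 0 t; have := f1 t T; rewrite f0 fT !ler0_norm; lra.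
Qed.

Lemma itv_partition_leS (s : seq R) i : itv_partition 0 1 s -> (i < size s)%N ->
  nth 1 (0 :: s) i <= nth 1 (0 :: s) i.+1.
Proof.
move=> [s0 _] ilt.
have srt : sorted <=%R (0 :: s).
  by apply: (sub_sorted _ (s0 : sorted <%R (0 :: s))) => u v; exact: ltW.
by apply: (sorted_leq_nth le_trans le_refl 1 srt); rewrite ?inE ?ltnS// ltnW.
Qed.

Lemma path_length_lipschitz (L : R) (f : R -> X) : 0 <= L ->
  (forall s t, mdist (f s) (f t) <= L * `|s - t|) -> (path_length f <= L%:E)%E.
Proof.
move=> L0 fL; apply: ge_ereal_sup => _ [s s01 <-]; rewrite lee_fin.
have H i : (0 <= i < size s)%N ->
    mdist (f (nth 1 (0 :: s) i)) (f (nth 1 (0 :: s) i.+1)) <=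
    L * nth 1 (0 :: s) i.+1 - L * nth 1 (0 :: s) i.
  move=> /andP[_ ilt]; rewrite (le_trans (fL _ _))// -mulrBr ler_wpM2l//.
  by rewrite ler0_norm ?opprB// subr_le0 itv_partition_leS.
apply: (le_trans (ler_sum_nat H)); rewrite telescope_sumr//=.
have [_ /eqP s1] := s01.
rewrite -[nth 1 _ _]/(nth 1 (0 :: s) (size (0 :: s)).-1) nth_last /= s1; lra.
Qed.

Lemma lipschitz_continuous (L : R) (f : R -> X) :
  (forall s t, mdist (f s) (f t) <= L * `|s - t|) -> continuous f.
Proof.
move=> fL s; apply/metricType_numDomainType.cvgrPdist_lt => e e0; near=> t.
have L1 : 0 < `|L| + 1 by rewrite ltr_wpDl.
apply: (le_lt_trans (fL _ _)); apply: (@le_lt_trans _ _ ((`|L| + 1) * `|s - t|)).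
  by rewrite ler_wpM2r// (le_trans (ler_norm L))// lerDl.
rewrite -ltr_pdivlMl// mulrC.
by near: t; apply: cvgr_dist_lt; [exact: cvg_id|exact: divr_gt0].
Unshelve. all: by end_near. Qed.

(** Rescaling time by [T] turns a nonexpansive path into a [T]-Lipschitz one on the unit
    interval. *)
Lemma joined_divergence gamma delta a b c K :
  joined (ball c (delta * dist_to_pair c a b - gamma)) K a b ->
  (divergence gamma delta a b c <= K%:E)%E.
Proof.
move=> [T [f [/andP[T0 TK] f1 f0 fT fA]]].
have gL s t : mdist (f (T * s)) (f (T * t)) <= T * `|s - t|.
  by rewrite (le_trans (f1 _ _))// -mulrBr normrM ger0_norm.
apply: (@le_trans _ _ T%:E); last by rewrite lee_fin.
apply: (le_trans _ (path_length_lipschitz T0 gL)).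
apply: ereal_inf_lbound; exists (fun t => f (T * t)) => //; split.
- by apply: continuous_subspaceT; exact: lipschitz_continuous gL.
- by rewrite mulr0.
- by rewrite mulr1.
- move=> t; rewrite in_itv/= => /andP[t0 t1]; apply: fA.
  by rewrite mulr_ge0//= ler_piMr.
Qed.

End Paths.

(** * Translating configurations by isometries *)

Section QuasiHomogeneous.
Context {R : realType} {X : metricType R}.
Implicit Types (A B : set X) (x y z a b c : X).

(** In a Cayley graph, translations are transitive on vertices and every point is within 1 of a
    vertex, hence the constant 2. *)
Definition quasi_homogeneous := forall x y, exists f g : X -> X,
  [/\ cancel g f, forall u v, mdist (f u) (f v) = mdist u v
    & mdist (f x) y <= 2].

Lemma joined_isometry (f g : X -> X) K rho a b c : cancel g f ->
  (forall u v, mdist (f u) (f v) = mdist u v) ->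
  joined (ball (f c) rho) K (f a) (f b) -> joined (ball c rho) K a b.
Proof.
move=> gK fE [T [p [TK p1 p0 pT pB]]].
have fI u v : f u = f v -> u = v.
  by move=> uv; apply: mdist_positivity; rewrite -fE uv mdistxx.
exists T, (g \o p); split=> //=.
- by move=> s t; rewrite -fE !gK.
- by apply: fI; rewrite gK.
- by apply: fI; rewrite gK.
- move=> t tT; have := pB t tT.
  by rewrite !ballEmdist/= -(fE c) gK.
Qed.

Hypotheses (XL : length_space (X := X)) (XH : quasi_homogeneous).

(* If the ball around [c] keeps [a] from [b], put a translate of the whole
   configuration at [a]: one of its two far points cannot be joined to [c]
   outside the new ball, hence lies on the same side of the old ball as [a],
   only deeper. Iterating leaves every bounded set. *)
Lemma bounded_joined (D : R) : (forall x y, mdist x y <= D) ->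
  exists K, forall a b c r, 4 < r -> r <= mdist c a -> r <= mdist c b ->
    joined (ball c (1 / 2 * r - 2)) K a b.
Proof.
(* [n] iterations exceed the diameter bound [D]. In each, [M] pays for the segments from [a] to [c']
   and from [c'] to [d]; [H] pays for a whole run followed by a segment to a centre. *)
move=> XD; pose n := Num.bound D; pose M := D + 4.
pose H := n%:R * M + 2 * D + 2.
exists (2 * H) => a0 b0 c0 r r4 ca0 cb0; apply: contrapT => c0ab.
have D4 : 4 < D by rewrite (lt_le_trans r4)// (le_trans ca0).
have ME : M = D + 4 by [].
have M0 : 0 <= M by lra.
have rD : r <= D by rewrite (le_trans ca0).
pose rho := 1 / 2 * r - 2.
pose bad c a b := [/\ r <= mdist c a, r <= mdist c b
  & ~ joined (ball c rho) (2 * H) a b].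
have badC c a b : bad c a b -> bad c b a.
  by case=> ? ? nab; split=> // /joined_sym.
have bad_near y : exists c a b, bad c a b /\ mdist c y <= 2.
  have [f [g [gK fE fy]]] := XH c0 y.
  exists (f c0), (f a0), (f b0); split=> //; split; rewrite ?fE//.
  by move=> /(joined_isometry gK fE).
have deep (k : nat) : (k <= n)%N -> forall c a b, bad c a b ->
    exists2 x, joined (ball c rho) (k%:R * M) a x & r + k%:R <= mdist c x.
  elim: k => [_ c a b [ca _ _]|k IH kn c a b [ca cb nab]].
    exists a; last by rewrite addr0.
    by rewrite mul0r; apply: joined_refl => //; rewrite ballEmdist/= /rho; lra.
  have [c' [a' [b' [bad' c'a]]]] := bad_near a.
  have cc' : r - 2 <= mdist c c'.
    by have := metric_triangle c c' a; lra.
  (* If both far points reached [c] within [H], they would be joined within [2 * H]. *)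
  have [d [e [bad'' nd]]] : exists d e, bad c' d e /\ ~ joined (ball c' rho) H d c.
    have [da|nda] := pselect (joined (ball c' rho) H a' c); last first.
      by exists a', b'.
    exists b', a'; split; first exact: badC.
    move=> db; case: bad' => _ _; apply.
    rewrite (_ : 2 * H = H + H); last by ring.
    exact: joined_trans da (joined_sym db).
  have [x dx c'x] := IH (ltnW kn) _ _ _ bad''.
  have kM : k%:R * M + M <= n%:R * M.
    by rewrite -[X in _ + X]mul1r -mulrDl ler_wpM2r ?natr1 ?ler_nat.
  (* From [z] in the old ball a segment to [c] would avoid the new ball, whose centre is at least
     [r - 2 = 2 * rho + 2] away from [c]. *)
  have far z : joined (ball c' rho) (n%:R * M) d z -> ~ ball c rho z.
    move=> dz; rewrite ballEmdist/= => cz; apply: nd.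
    apply: (@joinedW _ _ _ (ball c' rho) (n%:R * M + (mdist z c + 1))) => //.
      by rewrite metric_sym /H; move: cz; rewrite /rho; lra.
    apply: joined_trans dz _; apply: length_space_joined => // u.
    rewrite ballEmdist/= => zu; have := metric_triangle c u c'.
    have := mdist_ge0 z u; move: cz cc'; rewrite /rho.
    rewrite [mdist u c']metric_sym [mdist c u]metric_sym [mdist c z]metric_sym; lra.
  exists x.
    apply: (@joinedW _ _ _ (ball c rho) ((mdist a c' + 1) + ((mdist c' d + 1) + k%:R * M))) => //.
      rewrite -natr1 mulrDl mul1r [mdist a _]metric_sym.
      by have := XD c' d; lra.
    apply: joined_trans (_ : joined _ _ a c') _.
      apply: length_space_joined => // z; rewrite ballEmdist/=.
      have := metric_triangle c z a; have := mdist_ge0 z c'; rewrite /rho.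
      rewrite [mdist a c']metric_sym [mdist a z]metric_sym; lra.
    apply: joined_trans (_ : joined _ _ d x); last first.
      have [//|[z Bz dz]] := joined_prefix (ball c rho) dx; exfalso.
      by apply: far Bz; apply: joinedW dz => //; lra.
    rewrite metric_sym; apply: joined_sym.
    have [T [f [TK f1 f0 fT _]]] := XL d c' ltr01.
    (* A point of the new ball met before [f t] would be too near the end [c'] for [f t] to lie in
       the old ball. *)
    exists T, f; split=> // t tT Bft; apply: (far (f t)) => //.
    exists t, f; split=> //.
      have := XD d c'; have := mulr_ge0 (ler0n R k) M0; lra.
    move=> s st; rewrite ballEmdist/= => Bfs; move: Bft; rewrite ballEmdist/= => Bft.
    have := metric_triangle d (f s) c'; have := metric_triangle c (f t) c'.
    have := f1 0 s; have := f1 t T; rewrite f0 fT !ler0_norm; [|lra..].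
    by move: Bft Bfs cc'; rewrite [mdist c' _]metric_sym /rho; lra.
  (* Since [d] cannot reach [c], an almost geodesic from [x] to [c] meets the new ball. This detour
     has length at least [(r + k - rho) + (r - 2 - rho) = r + k + 2], and the error 1 still leaves
     depth [r + k + 1]. *)
  have [z] : exists2 z, mdist x z + mdist z c <= mdist x c + 1 & ball c' rho z.
    apply: contrapT => nz; apply: nd.
    apply: (@joinedW _ _ _ (ball c' rho) (k%:R * M + (mdist x c + 1))) => //.
      by have := XD x c; rewrite /H; lra.
    apply: joined_trans dx _; apply: length_space_joined => // z xz Bz.
    by apply: nz; exists z.
  rewrite ballEmdist/= -natr1 => xzc c'z.
  have := metric_triangle x z c'; have := metric_triangle c z c'.
  move: c'z c'x cc'; rewrite /rho [mdist c' _]metric_sym [mdist c' _]metric_sym.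
  by rewrite [mdist c z]metric_sym [mdist c x]metric_sym; lra.
have [x _] := deep n (leqnn _) c0 a0 b0 (And3 ca0 cb0 c0ab).
have := XD c0 x; have := archi_boundP (_ : 0 <= D); rewrite -/n; lra.
Qed.

(* Two halves of an almost geodesic centred near [a]: if both met the ball, they
   would do so at points at least [r - 1] apart, but its diameter is at most
   [r - 4]. *)
Lemma unbounded_escape (N : R) a c r : (forall D, exists x y, D < mdist x y) ->
  0 <= N -> 4 < r -> r <= mdist c a ->
  exists2 a', joined (ball c (1 / 2 * r - 2)) (N + 3) a a'
    & N - 3 <= mdist a a' <= N + 2.
Proof.
move=> Xoo N0 r4 ca; have [x [y xy]] := Xoo (2 * N).
have [T [f [TK f1 f0 fT _]]] := XL x y ltr01.
have [g [h [_ gE ga]]] := XH (f (T / 2)) a.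
(* The almost geodesic, moved so that its midpoint is within 2 of [a]. *)
pose p s := g (f (T / 2 + s)).
have p1 s t : mdist (p s) (p t) <= `|s - t|.
  by rewrite gE (le_trans (f1 _ _))// opprD addrACA subrr add0r.
have NT : 2 * N <= T.
  by have := f1 0 T; rewrite f0 fT ler0_norm; [lra|lra].
have p2 s t : - N <= s <= t -> t <= N -> t - s - 1 <= mdist (p s) (p t).
  move=> st tN; rewrite gE.
  have := metric_triangle x (f (T / 2 + s)) y.
  have := metric_triangle (f (T / 2 + s)) (f (T / 2 + t)) y.
  have := f1 0 (T / 2 + s); have := f1 (T / 2 + t) T.
  rewrite f0 fT !ler0_norm; lra.
have p0a : mdist (p 0) a <= 2 by rewrite /p addr0.
have ap0 : joined (ball c (1 / 2 * r - 2)) 3 a (p 0).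
  apply: (@joinedW _ _ _ (ball c (1 / 2 * r - 2)) (mdist a (p 0) + 1)) => //.
    by rewrite metric_sym; lra.
  apply: length_space_joined => // z; rewrite ballEmdist/=.
  have := metric_triangle c z a; have := mdist_ge0 z (p 0).
  rewrite [mdist a (p 0)]metric_sym [mdist a z]metric_sym; lra.
have cp0 : r - 2 <= mdist c (p 0) by have := metric_triangle c (p 0) a; lra.
have half (q : R -> X) : (forall s t, mdist (q s) (q t) <= `|s - t|) ->
    q 0 = p 0 -> N - 1 <= mdist (q 0) (q N) ->
    (forall t, 0 <= t <= N -> ~ ball c (1 / 2 * r - 2) (q t)) ->
    exists2 a', joined (ball c (1 / 2 * r - 2)) (N + 3) a a'
      & N - 3 <= mdist a a' <= N + 2.
  move=> q1 q0 qN qB; exists (q N).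
    rewrite [N + 3]addrC; apply: joined_trans ap0 _; rewrite -q0.
    by exists N, q; split=> //; lra.
  have := metric_triangle (p 0) a (q N); have := metric_triangle a (p 0) (q N).
  have := q1 0 N; rewrite q0 ler0_norm ?[mdist a (p 0)]metric_sym; first by rewrite q0 in qN; lra.
  by lra.
have [pB|] := pselect (forall t, 0 <= t <= N -> ~ ball c (1 / 2 * r - 2) (p t)).
  by apply: (half p) => //; have := p2 0 N; rewrite subr0; apply; lra.
move=> /existsNP[t /not_implyP[tN /contrapT Bt]]; rewrite ballEmdist/= in Bt.
apply: (half (fun s => p (- s))); rewrite ?oppr0//.
- by move=> s u; rewrite (le_trans (p1 _ _))// opprK addrC distrC.
- by rewrite metric_sym; have := p2 (- N) 0; rewrite sub0r opprK; apply; lra.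
- move=> s sN; rewrite ballEmdist/= => Bs.
  have := p2 (- s) t; have := p1 0 t; have := p1 (- s) 0.
  rewrite !ler0_norm; [|lra|lra].
  have := metric_triangle c (p t) (p 0); have := metric_triangle c (p (- s)) (p 0).
  have := metric_triangle (p (- s)) c (p t).
  rewrite [mdist (p 0) _]metric_sym [mdist (p (- s)) c]metric_sym.
  by move=> ? ? ? ? ? /(_ ltac:(lra) ltac:(lra)); lra.
Qed.

End QuasiHomogeneous.

(** * Discretization of rectifiable paths *)

Section Discretization.
Context {R : realType} {X : metricType R}.
Implicit Types f : R -> X.

(** Uniform continuity by compactness: the ends of steps that stay too long converge along an
    ultrafilter to one point, where continuity would fail. *)
Lemma fine_uniform_partition f (eta : R) : {within `[0, 1], continuous f} ->
  0 < eta -> exists2 m : nat, (0 < m)%N & forall i, (i < m)%N ->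
    mdist (f (i%:R / m%:R)) (f (i.+1%:R / m%:R)) <= eta.
Proof.
move=> /subspace_continuousP fc eta0; apply: contrapT => fine.
have coarse m : exists i, (i <= m)%N /\
    eta < mdist (f (i%:R / m.+1%:R)) (f (i.+1%:R / m.+1%:R)).
  apply: contrapT => fm; apply: fine; exists m.+1 => // i im.
  by rewrite leNgt; apply/negP => ?; apply: fm; exists i; rewrite -ltnS.
have /choice[i {coarse fine}] := coarse => /all_and2[im fi].
have [w [wU wF]] := ultraFilterLemma eventually_filter.
pose u n : R := (i n)%:R / n.+1%:R; pose v n : R := (i n).+1%:R / n.+1%:R.
have v01 n : v n \in `[0, 1].
  by rewrite in_itv/= divr_ge0//= ler_pdivrMr ?ltr0n// mul1r ler_nat ltnS.
have u01 n : u n \in `[0, 1].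
  rewrite in_itv/= divr_ge0//= ler_pdivrMr ?ltr0n// mul1r ler_nat.
  exact: leq_trans (im n) (leqnSn n).
have uw : cvg (u @ w).
  by apply: (@cvg_ultra_bounded _ _ _ _ 0 1); apply: nearW => n; have := u01 n; rewrite in_itv.
set l := lim (u @ w) in uw.
have l01 : l \in `[0, 1].
  rewrite in_itv/=; apply/andP; split.
    by apply: limr_ge => //; apply: nearW => n; have := u01 n; rewrite in_itv/= => /andP[].
  by apply: limr_le => //; apply: nearW => n; have := u01 n; rewrite in_itv/= => /andP[].
have vw : v @ w --> l.
  have -> : v = u \+ (fun n => n.+1%:R^-1).
    by apply/funext => n; rewrite /v /u /= -natr1 mulrDl mul1r.
  rewrite -[l]addr0; apply: cvgD => //.
  exact: cvg_trans (cvg_app _ wF) (@cvg_harmonic R).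
have fu (a : nat -> R) : (forall n, a n \in `[0, 1]) -> a @ w --> l ->
    \forall n \near w, mdist (f l) (f (a n)) < eta / 2.
  move=> a01 al.
  have /metricType_numDomainType.cvgrPdist_lt/(_ (eta / 2)) := fc l l01.
  rewrite divr_gt0// => /(_ isT); rewrite near_withinE => fl.
  have fa : \forall n \near w,
      a n \in `[0, 1] -> mdist (f l) (f (a n)) < eta / 2.
    exact: (al _ fl).
  by apply: filterS fa => n /(_ (a01 n)).
have : \forall n \near w, False.
  near=> n; have : mdist (f l) (f (u n)) < eta / 2 by near: n; exact: fu.
  have : mdist (f l) (f (v n)) < eta / 2 by near: n; exact: fu.
  have := metric_triangle (f (u n)) (f l) (f (v n)); have := fi n.
  by rewrite -/(u n) -/(v n) [mdist (f (u n)) (f l)]metric_sym; lra.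
by move=> /filter_ex[].
Unshelve. all: by end_near. Qed.

Lemma path_length_uniform_partition f m : (0 < m)%N ->
  ((\sum_(0 <= i < m)
      mdist (f (i%:R / m%:R)) (f (i.+1%:R / m%:R)))%:E <= path_length f)%E.
Proof.
move=> m0; have mR : (0 : R) < m%:R by rewrite ltr0n.
pose s : seq R := mkseq (fun i => i.+1%:R / m%:R) m.
have nths i : (i <= m)%N -> nth 1 (0 :: s) i = i%:R / m%:R.
  by case: i => [|i] im /=; [rewrite mul0r|rewrite nth_mkseq].
apply: ereal_sup_ubound; exists s.
  split.
    apply/(pathP 1) => i; rewrite size_mkseq => im.
    rewrite -[nth 1 s i]/(nth 1 (0 :: s) i.+1) !nths// 1?ltnW//.
    by rewrite ltr_pM2r ?invr_gt0// ltr_nat.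
  by rewrite (last_nth 1) size_mkseq nths// divff// pnatr_eq0 -lt0n.
rewrite size_mkseq; congr (_%:E); apply: eq_big_nat => i /andP[_ im].
by rewrite !nths// ltnW.
Qed.

(** Sampling nearly proportionally to arc length gives the Lipschitz constant [L], at the price of
    continuity and of an error [eta], which disappears in the cone. *)
Lemma rectifiable_discretize f (L eta : R) : {within `[0, 1], continuous f} ->
  (path_length f <= L%:E)%E -> 0 < eta -> exists F : R -> X,
  [/\ forall t, exists2 u, u \in `[0, 1] & F t = f u, F 0 = f 0, F 1 = f 1
    & forall s t, s \in `[0, 1] -> t \in `[0, 1] ->
        mdist (F s) (F t) <= L * `|s - t| + eta].
Proof.
move=> fc fL eta0; have [m m0 fm] := fine_uniform_partition fc eta0.
pose x i := f (i%:R / m%:R).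
pose S k := \sum_(0 <= i < k) mdist (x i) (x i.+1).
have SL : S m <= L.
  by rewrite -lee_fin; apply: le_trans fL; exact: path_length_uniform_partition.
have SS i : S i.+1 = S i + mdist (x i) (x i.+1) by rewrite /S big_nat_recr.
have S0 : S 0 = 0 by rewrite /S big_geq.
have Sx i k : mdist (x i) (x (i + k)%N) <= S (i + k)%N - S i.
  elim: k => [|k IH]; first by rewrite addn0 mdistxx subrr.
  rewrite addnS SS; have := metric_triangle (x i) (x (i + k)%N) (x (i + k).+1); lra.
have S_ge0 i : 0 <= S i.
  by have := Sx 0 i; rewrite S0 subr0; apply: le_trans; exact: mdist_ge0.
have L0 : 0 <= L by exact: le_trans SL.
(* Approximate parametrization proportional to arc length. *)
have /choice[idx idxP] t : exists i : 'I_m.+1, 0 <= t ->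
    S i <= t * L /\ forall j : 'I_m.+1, S j <= t * L -> (j <= i)%N.
  have [t0|t0] := leP 0 t; last by exists ord0; lra.
  have P0 : S (@ord0 m) <= t * L by rewrite S0 mulr_ge0.
  exists [arg max_(i > ord0 | S i <= t * L) val i] => _.
  by case: arg_maxnP.
have [_ /(_ ord_max)/=] := idxP 1 ler01; rewrite mul1r => /(_ SL) idx1.
exists (fun t => x (idx t)); split.
- move=> t; exists ((idx t)%:R / m%:R) => //.
  rewrite in_itv/= divr_ge0//= ler_pdivrMr ?ltr0n// mul1r ler_nat.
  by rewrite -ltnS ltn_ord.
(* The index chosen at time 0 may be positive, but the polygonal length up to it is zero. *)
- have [+ _] := idxP 0 (lexx _); rewrite mul0r => S0le.
  apply/esym/mdist_positivity/le_anti; rewrite mdist_ge0 andbT.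
  have := Sx 0 (idx 0); rewrite S0 subr0 add0n /x mul0r => /le_trans; exact.
- have -> : nat_of_ord (idx 1) = m.
    by apply/eqP; rewrite eqn_leq idx1 -ltnS ltn_ord.
  by rewrite /x divff// pnatr_eq0 -lt0n.
- suff H s t : 0 <= s -> s <= t ->
      mdist (x (idx s)) (x (idx t)) <= L * (t - s) + eta.
    move=> s t; rewrite !in_itv/= => /andP[s0 _] /andP[t0 _].
    have [st|/ltW ts] := leP s t.
      by rewrite ler0_norm ?opprB ?H// subr_le0.
    by rewrite metric_sym ger0_norm ?H// subr_ge0.
  move=> s0 st; have t0 := le_trans s0 st.
  have [Ss smax] := idxP s s0; have [St tmax] := idxP t t0.
  have ij : (idx s <= idx t)%N by apply: tmax; rewrite (le_trans Ss)// ler_wpM2r.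
  have := Sx (idx s) (idx t - idx s)%N; rewrite subnKC// => /le_trans; apply.
  have [im|im] := ltnP (idx s) m; last first.
    have -> : nat_of_ord (idx t) = idx s.
      by apply/eqP; rewrite eqn_leq ij (leq_trans _ im)// -ltnS ltn_ord.
    by rewrite subrr addr_ge0 ?(ltW eta0)// mulr_ge0// subr_ge0.
  (* By maximality of the index, the next sample lies beyond arc length [s * L], and one step costs
     at most [eta]. *)
  have : s * L < S (idx s).+1.
    rewrite ltNge; apply/negP => Ssi.
    by have := smax (Ordinal (im : (idx s).+1 < m.+1)%N) Ssi; rewrite ltnn.
  by rewrite SS; have := fm _ im; rewrite -/(x _) -/(x _); lra.
Qed.

End Discretization.

(** * From linear divergence to cones without cut-points *)

Section LinearDivergence.
Context {R : realType} {X : metricType R}.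

Lemma connected_pairwise (T : topologicalType) (A : set T) :
  (forall x y, A x -> A y -> exists C, [/\ connected C, C `<=` A, C x & C y]) ->
  connected A.
Proof.
have [->|/set0P[x Ax]] := eqVneq A set0; first by move=> _; exact: connected0.
move=> AC; have -> : A = \bigcup_(C in [set C | [/\ connected C, C `<=` A & C x]]) C.
  apply/seteqP; split=> [y Ay|y [C [_ CA _]] /CA//].
  by have [C [? ? ? ?]] := AC x y Ax Ay; exists C.
by apply: bigcup_connected => [|C []//]; exists x => C [].
Qed.

Section Limits.
Context (w : set_system nat) {wU : UltraFilter w} (o : nat -> X).
Context (d : nat -> {posnum R}) (d_oo : (d n)%:num @[n --> w] --> +oo).

Lemma cvg_scale_inv (c : R) : c / (d n)%:num @[n --> w] --> 0.
Proof.
rewrite -(mulr0 c); apply: cvgM; first exact: cvg_cst.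
by apply/gtr0_cvgV0 => //; apply: nearW.
Qed.

Lemma cone_mdistE (x y : cone_seq w o d) :
  mdist (cone_point x) (cone_point y) = lim (scaled_dist d x y @ w).
Proof. exact: cone_distE. Qed.

Lemma cvg_scaled_dist (x y : cone_seq w o d) :
  scaled_dist d x y @ w --> mdist (cone_point x) (cone_point y).
Proof. by rewrite cone_mdistE; exact: is_cvg_cone_pdist. Qed.

End Limits.

(** The discretized paths have a pointwise ultralimit. Division by [d n] removes the additive
    errors, making it Lipschitz and hence continuous, while the avoided radius stays bounded
    below. *)
Lemma linear_Div_no_cut_point (gamma delta K : R) : 0 < delta ->
  (forall n, 0 <= n -> (Div X gamma delta n <= (K * n + K)%:E)%E) ->
  forall (w : set_system nat) (wU : UltraFilter w) (o : nat -> X)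
    (d : nat -> {posnum R}), (d n)%:num @[n --> w] --> +oo ->
  forall p : asymptotic_cone w o d, ~ cut_point p.
Proof.
move=> delta0 DivK.
have K0 : 0 <= K.
  have := DivK 0 (lexx _); rewrite mulr0 add0r -lee_fin; apply: le_trans.
  by rewrite le_max lexx.
move=> w wU o d d_oo p; apply; apply: connected_pairwise => x y.
rewrite -[x]cone_reprK -[y]cone_reprK -[p]cone_reprK.
move: (cone_repr x) (cone_repr y) (cone_repr p) => {}x {}y {}p.
set xc : asymptotic_cone w o d := cone_point x.
set yc : asymptotic_cone w o d := cone_point y.
set pc : asymptotic_cone w o d := cone_point p => xp yp.
pose r n := dist_to_pair (p n) (x n) (y n).
(* The last summand makes [L n] strictly larger than the divergence, so that a path shorter than
   [L n] exists. *)
pose L n := K * mdist (x n) (y n) + K + 1.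
pose good n (F : R -> X) := [/\ forall t, ~ ball (p n) (delta * r n - gamma) (F t),
  F 0 = x n, F 1 = y n & forall s t, s \in `[0, 1] -> t \in `[0, 1] ->
        mdist (F s) (F t) <= L n * `|s - t| + 1].
(* The condition [0 < r n] holds for [w]-almost all [n]; elsewhere a constant map is the default. *)
have /choice[F FP] n : exists F, 0 < r n -> good n F.
  have [r0|r0] := ltP 0 (r n); last by exists (fun=> x n).
  have : (divergence gamma delta (x n) (y n) (p n) < (L n)%:E)%E.
    apply: (@le_lt_trans _ _ (K * mdist (x n) (y n) + K)%:E).
      apply: le_trans (DivK _ (mdist_ge0 (x n) (y n))).
      rewrite le_max; apply/orP; right; apply: ereal_sup_ubound.
      by exists (x n), (y n), (p n); split.
    by rewrite lte_fin ltrDl.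
  move=> /ereal_inf_lt[_ [f [fc f0 f1 fA] <-]] /ltW fL.
  have [F [Ff F0 F1 FL]] := rectifiable_discretize fc fL ltr01.
  exists F => _; split=> //; [|by rewrite F0|by rewrite F1].
  by move=> t; have [u u01 ->] := Ff t; exact: fA.
pose m := Num.min (mdist pc xc) (mdist pc yc) / 2.
have m0 : 0 < m.
  rewrite divr_gt0// lt_min !mdist_gt0 !(eq_sym pc).
  by apply/andP; split; exact/eqP.
have xym (z : cone_seq w o d) : m * 2 <= mdist pc (cone_point z) ->
    \forall n \near w, m < scaled_dist d p z n.
  move=> mz; apply: (cvgr_gt (mdist pc (cone_point z))); first exact: cvg_scaled_dist.
  by apply: lt_le_trans mz; rewrite ltr_pMr ?ltr1n.
have rm : \forall n \near w, m < r n / (d n)%:num.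
  near=> n; rewrite /r /dist_to_pair minr_pMl ?invr_ge0// lt_min.
  by apply/andP; split; near: n; apply: xym; rewrite /m divfK// ge_min lexx ?orbT.
have goodF : \forall n \near w, good n (F n).
  apply: filterS rm => n mr; apply: FP.
  by have := lt_trans m0 mr; rewrite pmulr_lgt0// invr_gt0.
pose Lam := K * mdist xc yc.
have Llim (c : R) : (L n * c + 1) / (d n)%:num @[n --> w] --> Lam * c.
  have -> : (fun n => (L n * c + 1) / (d n)%:num) =
     (fun n => K * scaled_dist d x y n * c + ((K + 1) * c + 1) / (d n)%:num).
    by apply/funext => n; rewrite /L /scaled_dist; field.
  rewrite -[Lam * c]addr0; apply: cvgD; last exact: cvg_scale_inv.
  by apply: cvgM (cvgM (cvg_cst _) _) (cvg_cst _); exact: cvg_scaled_dist.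
have Gcvg t : cvg (scaled_dist d (fun n => F n (clip t)) o @ w).
  pose lx := lim (scaled_dist d x o @ w).
  apply: (@cvg_ultra_bounded _ _ _ _ 0 (Lam * clip t + 1 + (lx + 1))).
  near=> n; rewrite /scaled_dist divr_ge0 ?mdist_ge0//=.
  have : (L n * clip t + 1) / (d n)%:num <= Lam * clip t + 1.
    by near: n; apply: (cvgr_le _ (Llim _)); rewrite ltrDl.
  have : scaled_dist d x o n <= lx + 1.
    by near: n; apply: (cvgr_le lx); [exact: cone_valP|rewrite ltrDl].
  move=> xo FL; apply: (le_trans _ (lerD FL xo)).
  rewrite /scaled_dist -mulrDl ler_pM2r ?invr_gt0//.
  apply: le_trans (metric_triangle _ (x n) _) _; rewrite lerD2r.
  have [_ <- _ FLn] : good n (F n) by near: n.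
  apply: le_trans (FLn _ _ (clip01 t) _) _; first by rewrite in_itv/= lexx ler01.
  rewrite subr0 ger0_norm//.
  by have := clip01 t; rewrite in_itv => /andP[].
pose G t := @cone_point R X w wU o d (ConeSeq (Gcvg t)).
have GL s t : mdist (G s) (G t) <= Lam * `|s - t|.
  apply: (@le_trans _ _ (Lam * `|clip s - clip t|)); last first.
    by rewrite ler_wpM2l ?clip_nonexpansive// mulr_ge0// mdist_ge0.
  rewrite /G cone_mdistE -(cvg_lim _ (Llim _))//.
  apply: ler_lim; [exact: is_cvg_cone_pdist|by apply/cvg_ex; eexists; exact: Llim|].
  apply: filterS goodF => n [_ _ _ FL].
  by rewrite /scaled_dist ler_pM2r ?invr_gt0// FL ?clip01.
have Gend t (z : cone_seq w o d) : t \in `[0, 1] ->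
    (\forall n \near w, F n t = z n) -> G t = cone_point z.
  move=> t01 Fz; apply/cone_pointP/cvg_lim => //.
  apply: cvg_near_cst.
  by apply: filterS Fz => n Fz; rewrite /scaled_dist /= clip_id// Fz mdistxx mul0r.
exists (G @` `[0, 1]); split.
- apply: connected_continuous_connected; first exact: segment_connected.
  by apply: continuous_subspaceT; exact: lipschitz_continuous GL.
- move=> _ [t _ <-] Gp.
  (* After scaling, [delta * r n] exceeds [delta * m], and [gamma] takes away at most half of
     this. *)
  have : delta * m / 2 <= mdist pc (G t).
    rewrite cone_mdistE; apply: limr_ge; first exact: is_cvg_cone_pdist.
    near=> n; have [FB _ _ _] : good n (F n) by near: n.
    have := FB (clip t); rewrite ballEmdist/= => /negP; rewrite -leNgt => rF.
    have mr : m < r n / (d n)%:num by near: n.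
    have : gamma / (d n)%:num <= delta * m / 2.
      by near: n; apply: (cvgr_le _ (cvg_scale_inv d_oo gamma)); rewrite divr_gt0// mulr_gt0.
    rewrite ler_pdivrMr// => gd; rewrite /scaled_dist /= ler_pdivlMr//.
    move: mr; rewrite ltr_pdivlMr// => mr; have := ltr_pM2l delta0 (m * (d n)%:num) (r n).
    by rewrite mr => /idP; lra.
  by rewrite Gp mdistxx leNgt divr_gt0// mulr_gt0.
- exists 0; first by rewrite /= in_itv/= lexx ler01.
  by apply: Gend; [rewrite in_itv/= lexx ler01|apply: filterS goodF => n []].
- exists 1; first by rewrite /= in_itv/= lexx ler01.
  by apply: Gend; [rewrite in_itv/= lexx ler01|apply: filterS goodF => n []].
Unshelve. all: by end_near. Qed.

End LinearDivergence.

(** * From cones without cut-points to linear divergence *)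

Section NoCutPoint.
Context {R : realType} {X : metricType R}.
Implicit Types (a b c : X).
Hypotheses (XL : length_space (X := X)) (XH : quasi_homogeneous (X := X)).

(** If the distance from [c] to the pair is at most 4, the ball is empty; if it exceeds the distance
    of [a] and [b], an almost geodesic misses the ball. *)
Lemma joined_or_far a b c :
  joined (ball c (1 / 2 * dist_to_pair c a b - 2)) (mdist a b + 1) a b \/
  4 < dist_to_pair c a b <= mdist a b.
Proof.
have [|far] := boolP (4 < dist_to_pair c a b <= mdist a b); first by right.
left; apply: length_space_joined => // z azb; rewrite ballEmdist/= => cz.
have ca : dist_to_pair c a b <= mdist c a by rewrite ge_min lexx.
have cb : dist_to_pair c a b <= mdist c b by rewrite ge_min lexx orbT.
have := metric_triangle c z a; have := metric_triangle c z b.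
have := mdist_ge0 c z; rewrite [mdist z a]metric_sym.
by move: far; rewrite negb_and -leNgt -ltNge => /orP[]; lra.
Qed.

Section Reach.
Context (w : set_system nat) {wU : UltraFilter w} (c : nat -> X).
Context (d : nat -> {posnum R}) (d_oo : (d n)%:num @[n --> w] --> +oo).
Context (a : nat -> X).

(** Coarse connectivity at scale [d n]: both constants are uniform in [n] but may worsen from one
    [z] to the next. *)
Definition reach (z : nat -> X) := exists K e : R, 0 < e /\
  \forall n \near w, joined (ball (c n) (e * (d n)%:num)) (K * (d n)%:num) (a n) (z n).

(** After scaling, the segment starts at distance [3/4 * rho] from [c] and has length at most
    [rho / 2 + rho / 8], where [rho / 8] absorbs the error 1; so it stays [rho / 8] away from
    [c]. *)
Lemma reach_step (z z' : cone_seq w c d) (rho : R) : 0 < rho ->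
  (\forall n \near w, rho * (3 / 4) < scaled_dist d z c n) ->
  (\forall n \near w, scaled_dist d z z' n < rho / 2) -> reach z -> reach z'.
Proof.
move=> rho0 zc zz' [K [e [e0 az]]].
exists (K + rho), (Num.min e (rho / 8)); split.
  by rewrite lt_min e0 divr_gt0.
have d8 : \forall n \near w, 1 / (d n)%:num <= rho / 8.
  by apply: (cvgr_le _ (cvg_scale_inv d_oo 1)); rewrite divr_gt0.
near=> n.
have zcn : rho * (3 / 4) * (d n)%:num < mdist (z n) (c n).
  by rewrite -ltr_pdivlMr//; near: n.
have zzn : mdist (z n) (z' n) < rho / 2 * (d n)%:num.
  by rewrite -ltr_pdivrMr//; near: n.
have dn : 1 <= rho / 8 * (d n)%:num by rewrite -ler_pdivrMr//; near: n.
apply: (@joinedW _ _ _ (ball (c n) (Num.min e (rho / 8) * (d n)%:num))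
  (K * (d n)%:num + (mdist (z n) (z' n) + 1))) => //.
  have : 0 < rho * (d n)%:num by rewrite mulr_gt0.
  by lra.
apply: joined_trans (_ : joined _ _ _ (z n)) _.
  apply: (@joinedW _ _ _ (ball (c n) (e * (d n)%:num)) (K * (d n)%:num)) => //.
    rewrite !ballEmdist => u /= /lt_le_trans; apply.
    by rewrite ler_pM2r// ge_min lexx.
  by near: n.
apply: length_space_joined => // u; rewrite ballEmdist/= => zu cu.
have : mdist (c n) u < rho / 8 * (d n)%:num.
  by apply: lt_le_trans cu _; rewrite ler_pM2r// ge_min lexx orbT.
have := metric_triangle (z n) u (c n); have := mdist_ge0 u (z' n).
by rewrite [mdist u (c n)]metric_sym; lra.
Unshelve. all: by end_near. Qed.

Lemma reach_cone (z z' : cone_seq w c d) (C : cone_seq w c d) : C =1 c ->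
  0 < cone_pdist z C -> cone_pdist z z' < cone_pdist z C / 2 -> reach z -> reach z'.
Proof.
move=> Cc zC zz'; apply: (reach_step zC).
  have -> : scaled_dist d z c = scaled_dist d z C.
    by apply/funext => n; rewrite /scaled_dist Cc.
  apply: (cvgr_gt (cone_pdist z C)); first exact: is_cvg_cone_pdist.
  by lra.
by apply: (cvgr_lt (cone_pdist z z')) => //; exact: is_cvg_cone_pdist.
Qed.

(* In the cone, the set of reached points different from [C] is open, and closed
   in the complement of [C]. *)
Lemma reach_connected (A B C : cone_seq w c d) : C =1 c -> A =1 a ->
  0 < cone_pdist A C -> 0 < cone_pdist B C ->
  ~ cut_point (@cone_point R X w wU c d C) -> reach B.
Proof.
move=> Cc Aa AC0 BC0 /contrapT.
set Y := asymptotic_cone w c d; set p : Y := cone_point _ => pc.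
pose Q : set Y := [set z | z <> p /\ reach (cone_repr z)].
have mE (x y : cone_seq w c d) : cone_pdist x y = mdist (cone_point x : Y) (cone_point y).
  exact: esym (cone_distE x y).
have dp (z : Y) : mdist z p = cone_pdist (cone_repr z) C.
  by rewrite mE cone_reprK.
have step (z z' : Y) : z <> p -> reach (cone_repr z) -> mdist z z' < mdist z p / 2 ->
    reach (cone_repr z').
  move=> zp rz zz'; apply: (reach_cone Cc _ _ rz); rewrite -?dp.
    by rewrite mdist_gt0; exact/eqP.
  exact: zz'.
have repr0 (z : cone_seq w c d) :
    mdist (cone_point z : Y) (cone_point (cone_repr (cone_point z : Y))) = 0.
  by rewrite cone_reprK mdistxx.
have AQ : Q (cone_point A).
  split=> [Ap|]; first by move: AC0; rewrite mE Ap mdistxx ltxx.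
  (* A sequence and its chosen representative coincide in the cone, and a constant path joins [A] to
     itself. *)
  apply: (reach_cone Cc AC0); first by rewrite mE repr0 divr_gt0.
  exists 0, (cone_pdist A C / 2); split; first by rewrite divr_gt0.
  have AC : \forall n \near w, cone_pdist A C / 2 < scaled_dist d A C n.
    apply: (cvgr_gt (cone_pdist A C)); first exact: is_cvg_cone_pdist.
    by lra.
  apply: filterS AC => n; rewrite /scaled_dist ltr_pdivlMr// Aa Cc => AC.
  rewrite mul0r; apply: joined_refl => //; rewrite ballEmdist/= metric_sym.
  by lra.
have oQ : open Q.
  rewrite openE => z [zp rz]; have z0 : 0 < mdist z p by rewrite mdist_gt0; exact/eqP.
  apply/nbhs_ballP; exists (mdist z p / 2); first by rewrite /= divr_gt0.
  move=> z'; rewrite ballEmdist/= => zz'; split; last exact: step zz'.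
  by move=> z'p; move: zz'; rewrite z'p; lra.
have cQ : Q = [set~ p] `&` closure Q.
  apply/seteqP; split=> [z Qz|z [zp clz]]; first by split; [case: Qz|exact: subset_closure].
  have z0 : 0 < mdist z p by rewrite mdist_gt0; exact/eqP.
  (* Within a quarter of the distance from [z] to [p], [z'] keeps three quarters of it from [p], and
     half of that exceeds a quarter. *)
  have [z' [[z'p rz'] /=]] := clz _ (nbhsx_ballx z _ (divr_gt0 z0 (ltr0n R 4))).
  rewrite ballEmdist/= => zz'; split=> //; apply: step rz' _ => //.
  by have := metric_triangle z z' p; rewrite [mdist z' z]metric_sym; lra.
have QE : Q = [set~ p].
  apply: pc; first by exists (cone_point A).
    by exists Q => //; apply/seteqP; split=> [z Qz|z []//]; split=> //; case: Qz.
  by exists (closure Q) => //; exact: closed_closure.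
have [Bp rB] : Q (cone_point B).
  rewrite QE /= => Bp; move: BC0.
  by rewrite mE Bp mdistxx ltxx.
have rp : 0 < cone_pdist (cone_repr (cone_point B : Y)) C.
  by rewrite -dp -mE.
by apply: (reach_cone Cc rp _ rB); rewrite mE metric_sym repr0 divr_gt0.
Qed.

End Reach.

Lemma no_cut_point_joined :
  (forall (w : set_system nat) (wU : UltraFilter w), nonprincipal w ->
   forall (o : nat -> X) (d : nat -> {posnum R}),
     (d n)%:num @[n --> w] --> +oo ->
   forall p : asymptotic_cone w o d, ~ cut_point p) ->
  (forall D, exists x y : X, D < mdist x y) ->
  exists K, forall a b c, 0 < dist_to_pair c a b ->
    joined (ball c (1 / 2 * dist_to_pair c a b - 2)) (K * mdist a b + K) a b.
Proof.
move=> noCP Xoo; apply: contrapT => noK.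
(* The square makes [K n * D n] equal to [n.+1 * s n], eventually beyond any fixed multiple of the
   scale [s n] chosen below. *)
pose K n : R := n.+1%:R ^+ 2.
have /choice[abc] n : exists t : X * X * X, 0 < dist_to_pair t.2 t.1.1 t.1.2 /\
    ~ joined (ball t.2 (1 / 2 * dist_to_pair t.2 t.1.1 t.1.2 - 2))
        (K n * mdist t.1.1 t.1.2 + K n) t.1.1 t.1.2.
  apply: contrapT => nt; apply: noK; exists (K n) => a b c r0.
  by apply: contrapT => abc; apply: nt; exists (a, b, c).
move=> /all_and2[_].
pose a n := (abc n).1.1; pose b n := (abc n).1.2; pose c n := (abc n).2.
pose D n := mdist (a n) (b n); pose r n := dist_to_pair (c n) (a n) (b n).
pose B n := ball (c n) (1 / 2 * r n - 2).
rewrite -/(forall n, ~ joined (B n) (K n * D n + K n) (a n) (b n)) => nabc.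
have K1 n : 1 <= K n by rewrite exprn_ege1// ler1n.
have rD n : 4 < r n <= D n.
  have [abn|//] := joined_or_far (a n) (b n) (c n).
  exfalso; apply: (nabc n); apply: joinedW abn => //.
  have := K1 n; have := mdist_ge0 (a n) (b n); rewrite -/(D n).
  by have := ler_wpM2r (mdist_ge0 (a n) (b n)) (K1 n); rewrite -/(D n) mul1r; lra.
(* [D n] is negligible with respect to the scale [s n], so that the balls [B n]
   collapse to a point of the cone, yet [s n] is negligible with respect to
   the length [K n * D n]. *)
pose s n := n.+1%:R * D n.
have D4 n : 4 < D n by case/andP: (rD n); exact: lt_le_trans.
have s0 n : 0 < s n by rewrite mulr_gt0// (lt_trans _ (D4 n)).
pose d n := PosNum (s0 n).
(* Containing all cofinite sets makes [w] non-principal and sends [d n] to infinity. *)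
have [w [wU wF]] := ultraFilterLemma eventually_filter.
have wN N : \forall n \near w, (N <= n)%N by apply: wF; exists N.
have large (M : R) : \forall n \near w, M < n.+1%:R.
  near=> n; apply: le_lt_trans (real_ler_norm (num_real M)) _.
  apply: lt_le_trans (archi_boundP (normr_ge0 M)) _; rewrite ler_nat.
  by apply: leqW; near: n; exact: wN.
have w_np : nonprincipal w.
  move=> t wt; have : \forall n \near w, False.
    near=> n; have : n = t by near: n.
    have : (t.+1 <= n)%N by near: n; exact: wN.
    by move=> /[swap] ->; rewrite ltnn.
  by move=> /filter_ex[].
have d_oo : (d n)%:num @[n --> w] --> +oo.
  apply/cvgryPge => A; near=> n.
  have /ltW/le_trans -> // : A < n.+1%:R by near: n; exact: large.
  by rewrite /= ler_peMr//; have := D4 n; lra.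
have rDor n : mdist (c n) (a n) <= D n \/ mdist (c n) (b n) <= D n.
  by have /andP[_] := rD n; rewrite ge_min => /orP.
have ca n : r n <= mdist (c n) (a n) <= 2 * D n.
  rewrite ge_min lexx/=; have := D4 n.
  have := metric_triangle (c n) (b n) (a n); rewrite [mdist (b n) _]metric_sym -/(D n).
  by case: (rDor n); lra.
have cb n : r n <= mdist (c n) (b n) <= 2 * D n.
  rewrite ge_min lexx orbT/=; have := D4 n.
  have := metric_triangle (c n) (a n) (b n); rewrite -/(D n).
  by case: (rDor n); lra.
(* Points at distance of order [D n] from the centre are moved out to about [s n], so that they
   differ from the centre in the cone. *)
have escape (x : nat -> X) : (forall n, r n <= mdist (c n) (x n) <= 2 * D n) ->
    exists x' : nat -> X, forall n, joined (B n) (s n + 3) (x n) (x' n) /\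
      s n - 3 * D n <= mdist (x' n) (c n) <= s n + 3 * D n.
  move=> cx; suff /choice[x' x'P] n : exists y, joined (B n) (s n + 3) (x n) y /\
      s n - 3 * D n <= mdist y (c n) <= s n + 3 * D n by exists x'.
  have /andP[r4 _] := rD n; have /andP[rx xD] := cx n.
  have [y xy dxy] := unbounded_escape XL XH Xoo (ltW (s0 n)) r4 rx.
  exists y; split=> //; have := D4 n; move: xD.
  have := metric_triangle y (x n) (c n); have := metric_triangle (x n) (c n) y.
  by rewrite [mdist y _]metric_sym [mdist y _]metric_sym [mdist (x n) (c n)]metric_sym; lra.
have [a' /all_and2[aa' ca']] := escape a ca.
have [b' /all_and2[bb' cb']] := escape b cb.
have Ccvg : cvg (scaled_dist d c c @ w).
  apply: (@cvg_ultra_bounded _ _ _ _ 0 0); apply: nearW => n.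
  by rewrite /scaled_dist mdistxx mul0r lexx.
have half_scaled (x' : nat -> X) :
    (forall n, s n - 3 * D n <= mdist (x' n) (c n) <= s n + 3 * D n) ->
    \forall n \near w, 1 / 2 <= scaled_dist d x' c n <= 2.
  move=> cx'; near=> n; rewrite /scaled_dist ler_pdivlMr// ler_pdivrMr//=.
  have n6 : 6 < n.+1%:R :> R by near: n; exact: large.
  have : 6 * D n <= s n by rewrite ler_wpM2r ?ltW//; have := D4 n; lra.
  by have := cx' n; lra.
have xcvg (x' : nat -> X) :
    (forall n, s n - 3 * D n <= mdist (x' n) (c n) <= s n + 3 * D n) ->
    cvg (scaled_dist d x' c @ w).
  by move=> /half_scaled sx'; apply: cvg_ultra_bounded sx'.
pose C : cone_seq w c d := ConeSeq Ccvg.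
have xC (x : cone_seq w c d) : (forall n, s n - 3 * D n <= mdist (x n) (c n) <= s n + 3 * D n) ->
    0 < cone_pdist x C.
  move=> /half_scaled sx; apply: (@lt_le_trans _ _ (1 / 2)) => //.
  apply: limr_ge; first exact: is_cvg_cone_pdist.
  by apply: filterS sx => n /andP[].
have [L [e [e0 ab']]] := @reach_connected w wU c d d_oo a'
  (ConeSeq (xcvg a' ca')) (ConeSeq (xcvg b' cb')) C (fun=> erefl) (fun=> erefl)
  (xC (ConeSeq (xcvg a' ca')) ca') (xC (ConeSeq (xcvg b' cb')) cb')
  (noCP w wU w_np c d d_oo _).
have : \forall n \near w, False.
  near=> n; apply: (nabc n).
  (* The radius of [B n] is below [D n], which is at most [e * s n] once [n.+1] exceeds the inverse
     of [e]. *)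
  have Bn : B n `<=` ball (c n) (e * (d n)%:num).
    move=> u; rewrite /B !ballEmdist/= => /lt_le_trans; apply.
    have : e^-1 < n.+1%:R by near: n; exact: large.
    rewrite -(ltr_pM2l e0) divff ?gt_eqF// => en.
    rewrite /s.
    have D0 : 0 <= D n by exact: mdist_ge0.
    by have := ler_wpM2r D0 (ltW en); rewrite mul1r -mulrA; have := rD n; have := D4 n; lra.
  (* The total is [(L + 2) * s n + 6], at most [(L + 8) * s n] because [s n] exceeds 1. *)
  apply: (@joinedW _ _ _ (B n) ((s n + 3) + (L * s n + (s n + 3)))) => //.
    have : L + 8 < n.+1%:R by near: n; exact: large.
    move=> /ltW/(ler_wpM2r (ltW (s0 n))).
    have -> : n.+1%:R * s n = K n * D n by rewrite /K /s mulrA -expr2.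
    have : D n <= s n by rewrite ler_peMl ?ler1n//; have := D4 n; lra.
    by have := D4 n; have := K1 n; lra.
  apply: joined_trans (aa' n) _; apply: joined_trans (joined_sym (bb' n)).
  by apply: (joinedW Bn (lexx _)); near: n.
by move=> /filter_ex[].
Unshelve. all: by end_near. Qed.

End NoCutPoint.

(** * Almost geodesics and translations in Cayley graphs *)

Section CayleyGraph.
Context {R : realType} {G : groupType} {S : seq G} (genS : generates S).
Notation X := (cayley_graph R genS).
Implicit Types (g h k : G) (x y : X).

Lemma cell_pointP g h (t : R) : cayley_cell S g h ->
  exists g' h', cayley_cell S g' h' /\ in_cell g' h' (barycentric g h (clip t)).
Proof.
by move=> gh; exists g, h; split=> //; exists (clip t) => //; have := clip01 t; rewrite in_itv.
Qed.

Definition cell_point g h (gh : cayley_cell S g h) (t : R) : X :=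
  CayleyPoint (cell_pointP t gh).

Lemma cell_point_nonexpansive g h (gh : cayley_cell S g h) :
  nonexpansive (cell_point gh).
Proof.
move=> s t; have t01 (u : R) : in_cell g h (barycentric g h (clip u)).
  by exists (clip u) => //; have := clip01 u; rewrite in_itv.
apply: le_trans (clip_nonexpansive s t).
apply: (@le_trans _ _ `|cell_point gh s g - cell_point gh t g|).
  apply: (cayley_dist_le genS); apply: segment_chain1; exists g, h.
  by split=> //; exact: t01.
rewrite /= /barycentric eqxx; case: eqP => _ /=.
  by rewrite !mulr1 !subrK subrr normr0.
by rewrite !mulr1 !mulr0 !addr0 opprB addrC addrA subrK [leRHS]distrC.
Qed.

(** The affine parametrization of the cell gives the path; in a degenerate cell both points
    agree. *)
Lemma cell_segment_joined x y l : cell_segment x y l -> joined set0 l x y.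
Proof.
move=> [g [h [gh [t t01 xt] [u u01 yu] ->]]].
have E (z : X) (v : R) : 0 <= v <= 1 -> coords z = barycentric g h v -> z = cell_point gh v.
  by move=> v01 zv; apply: cayley_point_eq => k; rewrite zv /= clip_id// in_itv.
rewrite (E x t)// (E y u)// /= !clip_id ?in_itv//= /barycentric eqxx !mulr1.
case: eqP => [gh'|_].
  rewrite (_ : cell_point gh t = cell_point gh u); first exact: joined_refl.
  apply: cayley_point_eq => k /=; rewrite /barycentric -gh'; ring.
rewrite !mulr0 !addr0 opprB addrC addrA subrK.
wlog tu : t u t01 u01 {x y xt yu} / t <= u => [H|].
  have [/H|/ltW ut] := leP t u; first exact.
  by rewrite distrC; apply: joined_sym; exact: H.
rewrite ger0_norm ?subr_ge0//.
exists (u - t), (fun s => cell_point gh (t + s)); split=> //.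
- by rewrite subr_ge0 tu lexx.
- move=> s s'; rewrite (le_trans (cell_point_nonexpansive _ _ _))//.
  by rewrite opprD addrACA subrr add0r.
- by rewrite addr0.
- by rewrite addrC subrK.
- by move=> s _ [].
Qed.

Lemma segment_chain_joined x y l : segment_chain x y l -> joined set0 l x y.
Proof.
elim=> {x y l} [x|x y z l m xy _ yz]; first exact: joined_refl.
exact: joined_trans (cell_segment_joined xy) yz.
Qed.

Lemma cayley_length_space : length_space (X := X).
Proof.
move=> x y e e0.
have [l xy /ltW le] := inf_adherent e0 (segment_chain_has_inf genS x y).
exact: joinedW le (segment_chain_joined xy).
Qed.

Lemma translate_cell k g h : cayley_cell S g h -> cayley_cell S (k * g)%g (k * h)%g.
Proof.
move=> [->|[s sS gh]]; first by left.
by right; exists s => //; case: gh => ->; [left|right]; rewrite mulgA.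
Qed.

Lemma translate_in_cell k g h (x : G -> R) : in_cell g h x ->
  in_cell (k * g)%g (k * h)%g (fun u => x (k^-1 * u)%g).
Proof.
move=> [t t01 ->]; exists t => //; apply/funext => u; rewrite /barycentric.
have E v : (k^-1 * u == v)%g = (u == k * v)%g.
  by apply/eqP/eqP => [<-|->]; rewrite ?mulVKg ?mulKg.
by rewrite !E.
Qed.

Lemma translateP k x : exists g h, cayley_cell S g h /\ in_cell g h (fun u => x (k^-1 * u)%g).
Proof.
have [g [h [gh xgh]]] := coordsP x.
by exists (k * g)%g, (k * h)%g; split; [exact: translate_cell|exact: translate_in_cell].
Qed.

(** Left multiplication by [k]: barycentric coordinates are pushed forward, hence the inverse. *)
Definition translate k x : X := CayleyPoint (translateP k x).

Lemma translateK k : cancel (translate k^-1%g) (translate k).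
Proof.
by move=> x; apply: cayley_point_eq => u /=; rewrite invgK mulVKg.
Qed.

Lemma translate_vertex k g : translate k (vertex R S g) = vertex R S (k * g)%g.
Proof.
apply: cayley_point_eq => u /=; rewrite /barycentric !mul0r !addr0 !subr0 !mul1r.
have -> // : (k^-1 * u == g)%g = (u == k * g)%g.
by apply/eqP/eqP => [<-|->]; rewrite ?mulVKg ?mulKg.
Qed.

Lemma translate_le k x y : mdist (translate k x) (translate k y) <= mdist x y.
Proof.
apply: (le_cayley_dist genS) => l xy; apply: (cayley_dist_le genS).
elim: xy => {x y l} [x|x y z l m [g [h [gh xg yg ->]]] _ IH]; first exact: segment_chain0.
apply: segment_chainS IH; exists (k * g)%g, (k * h)%g; split.
- exact: translate_cell.
- exact: translate_in_cell.
- exact: translate_in_cell.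
- by rewrite /= mulKg.
Qed.

Lemma translate_isometry k x y : mdist (translate k x) (translate k y) = mdist x y.
Proof.
apply/le_anti; rewrite translate_le/=.
have H z : z = translate k^-1%g (translate k z).
  by have := translateK k^-1%g z; rewrite invgK.
by rewrite {1}(H x) {1}(H y) translate_le.
Qed.

Lemma near_vertex x : exists g, mdist x (vertex R S g) <= 1.
Proof.
have [g [h [gh xgh]]] := coordsP x; exists g.
have : in_cell g h (vertex R S g).
  exists 0; first by rewrite lexx ler01.
  by apply/funext => k; rewrite /= /barycentric !mul0r.
move=> vgh; apply: (@le_trans _ _ `|x g - vertex R S g g|).
  by apply: (cayley_dist_le genS); apply: segment_chain1; exists g, h; split.
have [t t01 ->] := xgh; rewrite /= /barycentric eqxx.
by case: (g == h) => /=; rewrite ler_norml; lra.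
Qed.

(** Send a vertex near [x] to a vertex near [y]; each approximation costs 1. *)
Lemma cayley_quasi_homogeneous : quasi_homogeneous (X := X).
Proof.
move=> x y; have [g xg] := near_vertex x; have [h yh] := near_vertex y.
pose k := (h * g^-1)%g; exists (translate k), (translate k^-1%g).
split; [exact: translateK|exact: translate_isometry|].
have := metric_triangle (translate k x) (vertex R S h : X) y.
have <- : translate k (vertex R S g) = vertex R S h by rewrite translate_vertex mulgVK.
rewrite translate_isometry => /le_trans; apply.
rewrite translate_vertex mulgVK (_ : 2 = 1 + 1)// lerD//.
by rewrite metric_sym.
Qed.

End CayleyGraph.

(** * Linear growth of the divergence *)

Section LinearGrowth.
Context {R : realType}.

Lemma linear_growthP (f : R -> \bar R) : (forall n, 0 <= f n)%E ->
  linear_growth f <-> exists K : R, forall n, 0 <= n -> (f n <= (K * n + K)%:E)%E.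
Proof.
move=> f0; split=> [[a [b [a0 b0 [[C C1 fC] _]]]]|[K fK]].
  exists (C * a * C + C * b + C) => n n0; apply: (le_trans (fC n n0)).
  rewrite -EFinM -EFinD lee_fin.
  have C0 : 0 <= C by lra.
  have := mulr_ge0 (mulr_ge0 C0 a0) C0; have := mulr_ge0 (mulr_ge0 C0 b0) n0.
  by lra.
(* The equivalence absorbs linear terms, so [f] can be compared with the zero function. *)
exists 0, 0; split=> //; pose C := Num.max 2 K.
have C2 : 2 <= C by rewrite le_max lexx.
have KC : K <= C by rewrite le_max lexx orbT.
split; exists C; [lra| |lra|] => n n0.
  apply: (le_trans (fK n n0)); rewrite -EFinM -EFinD lee_fin.
  have := ler_wpM2r n0 KC; lra.
rewrite mul0r addr0; apply: adde_ge0; first by rewrite mule_ge0// lee_fin; lra.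
by rewrite lee_fin; have := mulr_ge0 (_ : 0 <= C) n0; lra.
Qed.

Lemma Div_ge0 (X : metricType R) gamma delta n : (0 <= Div X gamma delta n)%E.
Proof. by rewrite le_max lexx. Qed.

Lemma Div_le_linear (X : metricType R) gamma delta (K : R) :
  (forall a b c : X, 0 < dist_to_pair c a b ->
    joined (ball c (delta * dist_to_pair c a b - gamma)) (K * mdist a b + K) a b) ->
  exists L : R, forall n, 0 <= n -> (Div X gamma delta n <= (L * n + L)%:E)%E.
Proof.
move=> abcK; exists `|K| => n n0; rewrite ge_max; apply/andP; split.
  by rewrite lee_fin addr_ge0// mulr_ge0.
apply: ge_ereal_sup => _ [a [b [c [abn r0 ->]]]].
apply: (le_trans (joined_divergence (abcK a b c r0))); rewrite lee_fin lerD ?ler_norm//.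
apply: (@le_trans _ _ (`|K| * mdist a b)); last exact: ler_wpM2l.
by rewrite ler_wpM2r ?mdist_ge0// ler_norm.
Qed.

End LinearGrowth.

(** * The equivalence, by cases on the diameter of the graph *)

Theorem proposition1p1 (R : realType) (G : groupType) (S : seq G)
    (genS : generates S) :
  (forall (w : set_system nat) (wU : UltraFilter w), nonprincipal w ->
   forall (o : nat -> cayley_graph R genS) (d : nat -> {posnum R}),
     (d n)%:num @[n --> w] --> +oo ->
   forall p : asymptotic_cone w o d, ~ cut_point p)
  <->
  linear_growth (Div (cayley_graph R genS) 2 (1 / 2)).
Proof.
have XL := @cayley_length_space R G S genS.
have XH := @cayley_quasi_homogeneous R G S genS.
have linP := linear_growthP (@Div_ge0 _ (cayley_graph R genS) 2 (1 / 2)).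
split=> [noCP|/linP[K DivK] w wU _ o d d_oo]; last first.
  by apply: linear_Div_no_cut_point DivK _ _ _ _ d_oo; rewrite divr_gt0.
apply/linP.
have [Xoo|/existsNP[D XD]] :=
    pselect (forall D, exists x y : cayley_graph R genS, D < mdist x y).
  have [K abcK] := no_cut_point_joined XL XH noCP Xoo.
  exact: Div_le_linear abcK.
have {}XD (x y : cayley_graph R genS) : mdist x y <= D.
  by rewrite leNgt; apply/negP => xy; apply: XD; exists x, y.
have [K abcK] := bounded_joined XL XH XD.
(* [|D| + 1] pays for an almost geodesic that avoids the ball, [|K|] for the uniform bound on the
   remaining triples. *)
apply: (@Div_le_linear _ _ _ _ (`|K| + `|D| + 1)) => a b c r0.
have [abc|/andP[r4 _]] := joined_or_far XL a b c.
  apply: joinedW abc => //.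
  have := mdist_ge0 a b; have := normr_ge0 K; have := XD a b.
  have := ler_norm D; nra.
have := abcK a b c _ r4; rewrite !ge_min !lexx orbT => /(_ isT isT).
apply: joinedW => //; have := ler_norm K.
have := mulr_ge0 (_ : 0 <= `|K| + `|D| + 1) (mdist_ge0 a b).
have := normr_ge0 K; have := normr_ge0 D; nra.
Qed.
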